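(* Let $R\in\mathcal{S}_1\cap B(H)_+$ and let $(\Lambda_k,w_k,D_k,R^{(k)})$ be an adaptive content extraction process with $R^{(0)}=R$. (1) If the process is trace greedy, then for every $k\ge 1$, $$\mathrm{tr}(R^{(k)})\le\left(1-\frac{1}{\#\Lambda_{k-1}}\right)\mathrm{tr}(R^{(k-1)}).$$ Consequently, for every $m\ge 1$, $$\mathrm{tr}(R^{(m)})\le\prod_{j=0}^{m-1}\left(1-\frac{1}{\#\Lambda_j}\right)\mathrm{tr}(R).$$ (2) If the process is HS greedy, then for every $k\ge 1$ for which $\Gamma_{\Lambda_{k-1}}(R^{(k-1)})$ is defined, $$\|R^{(k)}\|_2^2\le\left(1-\frac{1}{\Gamma_{\Lambda_{k-1}}(R^{(k-1)})\,\#\Lambda_{k-1}}\right)\|R^{(k-1)}\|_2^2.$$ Consequently, for every $m\ge 1$ for which $\Gamma_{\Lambda_j}(R^{(j)})$ is defined for all $0\le j\le m-1$, $$\|R^{(m)}\|_2^2\le\prod_{j=0}^{m-1}\left(1-\frac{1}{\Gamma_{\Lambda_j}(R^{(j)})\,\#\Lambda_j}\right)\|R\|_2^2,$$ and, for every $m\ge 1$, $$\|R^{(m)}\|_2^2\le\prod_{j=0}^{m-1}\left(1-\frac{1}{(\#\Lambda_j)^2}\right)\|R\|_2^2.$$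
   Context: $H$ is a Hilbert space and $B(H)_+$ is the set of bounded positive operators on $H$; $\mathcal{S}_1$ is the trace class and $\mathcal{S}_2$ the Hilbert-Schmidt (HS) class with norm $\|\cdot\|_2$. $\mathcal{T}$ is a rooted finitely branching tree with root $\emptyset$; $|w|$ denotes the depth of a node $w$ and $\mathrm{ch}(w)$ the finite set of children of $w$. $\{W_w\}_{w\in\mathcal{T}}$ is a family of closed subspaces of $H$ with orthogonal projections $P_w$ such that: for each $n\ge 0$, $H=\bigoplus_{|w|=n}W_w$ (orthogonal sum), so $I=\sum_{|w|=n}P_w$; and for each node $w$, $W_w=\bigoplus_{v\in\mathrm{ch}(w)}W_v$ (orthogonal sum), i.e. $P_w=\sum_{v\in\mathrm{ch}(w)}P_v$ with $P_vP_{v'}=0$ for distinct $v,v'\in\mathrm{ch}(w)$. For $A\in B(H)_+$, $C_w(A)=A^{1/2}P_wA^{1/2}$. Fix a terminal depth $N\ge 1$. A finite set $\Lambda\subset\mathcal{T}$ is an active partition up to depth $N$ if (1) each $w\in\Lambda$ satisfies $|w|\le N$; (2) $\Lambda$ is an antichain (no node of $\Lambda$ is a proper ancestor of another); (3) every node $z\in\mathcal{T}$ with $|z|=N$ has a unique ancestor in $\Lambda$ (a node counts as its own ancestor). For $w\in\Lambda$ with $|w|<N$, the refinement of $\Lambda$ at $w$ is $\Lambda[w]=(\Lambda\setminus\{w\})\cup\mathrm{ch}(w)$. Given an active partition $\Lambda_0$ up to depth $N$ and $R\in B(H)_+$, an adaptive content extraction process consists of sequences $(\Lambda_k)_{k\ge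 0}$, $(w_k)_{k\ge 1}$, $(D_k)_{k\ge 1}$, $(R^{(k)})_{k\ge 0}$ such that $R^{(0)}=R$ and for each $k\ge 1$: $w_k\in\Lambda_{k-1}$; if $|w_k|<N$ then $\Lambda_k=\Lambda_{k-1}[w_k]$, and if $|w_k|=N$ then $\Lambda_k=\Lambda_{k-1}$; $D_k=C_{w_k}(R^{(k-1)})$ and $R^{(k)}=R^{(k-1)}-D_k$. The process is trace greedy if for every $k\ge 1$ the node $w_k$ maximizes $\mathrm{tr}(C_w(R^{(k-1)}))$ over $w\in\Lambda_{k-1}$; it is HS greedy if for every $k\ge 1$ the node $w_k$ maximizes $\|C_w(R^{(k-1)})\|_2$ over $w\in\Lambda_{k-1}$. For $A\in\mathcal{S}_2\cap B(H)_+$ and an active partition $\Lambda$, $\Gamma_\Lambda(A)=\|A\|_2^2\big/\sum_{w\in\Lambda}\|C_w(A)\|_2^2$, defined whenever the denominator is nonzero. *)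

(* Defs.v *)
From HB Require Import structures.
From mathcomp Require Import all_boot all_order all_algebra finmap.
From mathcomp Require Import all_classical all_reals all_analysis.
From mathcomp Require Import complex.

Set Implicit Arguments.
Unset Strict Implicit.
Unset Printing Implicit Defensive.
Import Order.TTheory GRing.Theory Num.Theory.
Import numFieldNormedType.Exports.
Local Open Scope classical_set_scope.
Local Open Scope ring_scope.

(* A Hilbert space may be real or complex. *)
Variant scalar_kind := RealScalars | ComplexScalars.

Definition scalar (R : realType) (s : scalar_kind) : numFieldType :=
  if s is ComplexScalars then R[i]%C else R.

Definition sconj (R : realType) (s : scalar_kind) :
    scalar R s -> scalar R s :=
  match s with
  | RealScalars => fun x : R => x
  | ComplexScalars => fun x : R[i]%C => conjc x
  end.

Definition sre (R : realType) (s : scalar_kind) : scalar R s -> R :=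
  match s with
  | RealScalars => fun x : R => x
  | ComplexScalars => fun x : R[i]%C => complex.Re x
  end.
Arguments sconj {R s}.
Arguments sre {R s}.

Lemma sconj_zmod_morphism (R : realType) (s : scalar_kind) :
  zmod_morphism (@sconj R s).
Proof. by case: s => //= x y; exact: rmorphB. Qed.
Lemma sconj_monoid_morphism (R : realType) (s : scalar_kind) :
  monoid_morphism (@sconj R s).
Proof. by case: s => //=; split; [exact: rmorph1|exact: rmorphM]. Qed.
Lemma sconjK (R : realType) (s : scalar_kind) : involutive (@sconj R s).
Proof. by case: s => //= x; exact: conjcK. Qed.
HB.instance Definition _ (R : realType) (s : scalar_kind) :=
  GRing.isZmodMorphism.Build _ _ (@sconj R s) (@sconj_zmod_morphism R s).
HB.instance Definition _ (R : realType) (s : scalar_kind) :=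
  GRing.isMonoidMorphism.Build _ _ (@sconj R s) (@sconj_monoid_morphism R s).
HB.instance Definition _ (R : realType) (s : scalar_kind) :=
  isInvolutive.Build _ (@sconj R s) (@sconjK R s).

(* The inner product is linear in its first argument. *)
Record hilbert (R : realType) (s : scalar_kind) := Hilbert {
  hilbert_sort :> completeNormedModType (scalar R s);
  inner : {dot hilbert_sort for @sconj R s};
  inner_norm : forall x, inner x x = `|x| ^+ 2 }.
Arguments inner {R s h}.

Section Operators.
Context {R : realType} {s : scalar_kind} {H : hilbert R s}.
Implicit Types (A B : H -> H) (V : set H) (E : set H) (x y e : H).

Definition bounded_op A : Prop :=
  linear A /\ exists M : scalar R s, forall x, `|A x| <= M * `|x|.

(* On a complex space symmetry follows from the last clause; on a real one it
   does not. In [scalar R s], [0 <= z] entails that [z] is real. *)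
Definition positive_op A : Prop :=
  [/\ bounded_op A,
      forall x y, inner (A x) y = inner x (A y) &
      forall x, 0 <= inner (A x) x].

(* [xget 0] selects the element of the given set, which is a singleton in all
   the cases of interest: the adjoint of a bounded operator, the square root
   of a positive operator, the orthogonal projection on a closed subspace. *)
Definition adjoint A : H -> H :=
  xget 0 [set B | bounded_op B /\ forall x y, inner (A x) y = inner x (B y)].

Definition op_sqrt A : H -> H :=
  xget 0 [set B | positive_op B /\ B \o B = A].

Definition op_abs A : H -> H := op_sqrt (adjoint A \o A).

Definition closed_subspace V : Prop :=
  [/\ V 0, forall (a : scalar R s) x y, V x -> V y -> V (a *: x + y) &
      closed V].

Definition orth_proj V : H -> H :=
  fun x => xget 0 [set p | V p /\ forall y, V y -> inner (x - p) y = 0].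

Definition orthonormal_basis E : Prop :=
  (forall e e', E e -> E e' -> inner e e' = (e == e')%:R) /\
  closure [set x | exists (F : {fset H}) (c : H -> scalar R s),
    [set` F] `<=` E /\ x = \sum_(e <- F) c e *: e] = [set: H].

(* Only meaningful for positive operators, as [\esum] is a supremum of finite
   partial sums. None of the sums below depends on the orthonormal basis E. *)
Definition trace E A : \bar R := \esum_(e in E) (sre (inner (A e) e))%:E.

Definition trace_class E A : Prop :=
  bounded_op A /\ (trace E (op_abs A) < +oo)%E.

Definition hs_norm E A : \bar R :=
  sqrte (\esum_(e in E) (sre (inner (A e) (A e)))%:E).

End Operators.

Section Trees.

(* A node [v] other than the root is a child of [parent v]; the value of
   [parent] at the root is a convention. *)
Record rooted_tree := RootedTree {
  node :> choiceType;
  root : node;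
  parent : node -> node;
  children : node -> {fset node};
  parent_root : parent root = root;
  parent_reach : forall w, exists n, iter n parent w == root;
  childrenP : forall w v,
    (v \in children w) = (v != root) && (parent v == w) }.

Context {T : rooted_tree}.
Implicit Types (v w z : T) (L : {fset T}) (N : nat).

Definition depth w : nat := ex_minn (parent_reach w).

Definition ancestor v w : Prop := exists n, iter n (@parent T) w = v.

Definition active_partition N L : Prop :=
  [/\ forall w, w \in L -> (depth w <= N)%N,
      forall v w, v \in L -> w \in L -> ancestor v w -> v = w &
      forall z, depth z = N -> exists! w, w \in L /\ ancestor w z].

Definition refine L w : {fset T} := ((L `\ w) `|` children w)%fset.

End Trees.

Section Contents.
Context {R : realType} {s : scalar_kind} {H : hilbert R s} {T : rooted_tree}.
Implicit Types (A : H -> H) (V : set H) (E : set H) (L : {fset T}) (N : nat).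

(* V is the orthogonal direct sum of the [U i], for i in the finite set J. *)
Definition orthogonal_sum (J : set T) (U : T -> set H) V : Prop :=
  (forall i j, J i -> J j -> i <> j ->
     forall x y, U i x -> U j y -> inner x y = 0) /\
  V = [set x | exists f : T -> H,
         (forall i, J i -> U i (f i)) /\ x = \sum_(i \in J) f i].

Definition subspace_tree (W : T -> set H) : Prop :=
  [/\ forall w, closed_subspace (W w),
      forall n, orthogonal_sum [set w | depth w = n] W [set: H] &
      forall w, orthogonal_sum [set` children w] W (W w)].

Definition content (W : T -> set H) (w : T) A : H -> H :=
  op_sqrt A \o orth_proj (W w) \o op_sqrt A.

(* The values [w 0] and [D 0] are not used. *)
Definition extraction_process (W : T -> set H) N (Rop : H -> H)
    (L : nat -> {fset T}) (w : nat -> T) (D Rk : nat -> H -> H) : Prop :=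
  [/\ active_partition N (L 0%N), Rk 0%N = Rop &
      forall k, [/\ w k.+1 \in L k,
        (depth (w k.+1) < N)%N -> L k.+1 = refine (L k) (w k.+1),
        depth (w k.+1) = N -> L k.+1 = L k,
        D k.+1 = content W (w k.+1) (Rk k) &
        Rk k.+1 = Rk k - D k.+1]].

Definition trace_greedy E (W : T -> set H)
    (L : nat -> {fset T}) (w : nat -> T) (Rk : nat -> H -> H) : Prop :=
  forall k v, v \in L k ->
    (trace E (content W v (Rk k)) <= trace E (content W (w k.+1) (Rk k)))%E.

Definition hs_greedy E (W : T -> set H)
    (L : nat -> {fset T}) (w : nat -> T) (Rk : nat -> H -> H) : Prop :=
  forall k v, v \in L k ->
    (hs_norm E (content W v (Rk k)) <=
     hs_norm E (content W (w k.+1) (Rk k)))%E.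

Definition gamma_den E (W : T -> set H) L A : \bar R :=
  (\sum_(w <- L) hs_norm E (content W w A) ^+ 2)%E.

(* Intended for positive Hilbert-Schmidt operators, for which both extended
   reals in [Gamma] are finite. *)
Definition Gamma_defined E (W : T -> set H) L A : Prop :=
  gamma_den E W L A <> 0%E.

Definition Gamma E (W : T -> set H) L A : R :=
  fine (hs_norm E A ^+ 2) / fine (gamma_den E W L A).

End Contents.

(* Main.v *)
From HB Require Import structures.
Require Import Defs.
From mathcomp Require Import all_boot all_order all_algebra finmap.
From mathcomp Require Import all_classical all_reals all_analysis.
From mathcomp Require Import complex ring lra.
Set Implicit Arguments.
Unset Strict Implicit.
Unset Printing Implicit Defensive.
Import Order.TTheory GRing.Theory Num.Theory.
Import numFieldNormedType.Exports.
Local Open Scope classical_set_scope.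
Local Open Scope ring_scope.

Local Notation scalar := Defs.scalar.
Local Notation root := Defs.root.
Local Notation content := Defs.content.

(** The projections on the subspaces of the active nodes add up to the identity,
    so the contents D_w = A^(1/2) P_w A^(1/2) of the current remainder A add up
    to A, and the next remainder A - D = A^(1/2) (1 - P) A^(1/2) is again
    positive. The greedy node carries at least the average of what there is, and
    removing it removes at least that average.

    For the trace this is immediate: tr A is the sum of the tr D_w, hence at most
    #L times the greedy one, and tr(A - D) = tr A - tr D.

    For the Hilbert-Schmidt norm two inequalities replace these equalities. One
    is |A - D|^2 + |D|^2 <= |A|^2, which says that the trace of the product of
    two positive operators is nonnegative ([hs_sqr_superadditive]). It is proved
    on finite blocks of matrix entries in the given basis, where it is the Schur
    product theorem ([schur_product_ge0]); the Parseval identity ([parseval])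
    passes to the full norms. With |D|^2 at least the average of the |D_w|^2,
    this is the estimate with Gamma. The other is |A|^2 <= #L sum |D_w|^2, from
    the Cauchy-Schwarz inequality for sums, which gives the factor
    1 - 1/(#L)^2.

    The definition of the contents requires that positive operators have positive
    square roots ([op_sqrtP]). These are obtained on real and complex spaces alike
    from the iteration Y_(n+1) = (T + Y_n^2)/2 for a symmetric contraction T,
    whose limit satisfies (1 - Y)^2 = 1 - T. The projections exist because the
    active subspaces form an orthogonal decomposition of the space, a property
    that holds for the initial partition and is preserved by refinement
    ([active_partition_orthogonal_sum], [refine_orthogonal_sum]).

    All traces and squared norms are sums in the extended reals, and each
    one-step estimate is proved there; the estimates over several steps multiply
    the one-step ones ([iterate_contraction]). *)

(** * Scalars *)

Section Scalars.
Context {R : realType} {s : scalar_kind}.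
Implicit Types z : scalar R s.

(** Real numbers as scalars: a positive real tolerance has to be turned into a
    scalar before it can serve as the radius of a ball of the Hilbert space. *)
Definition of_real : R -> scalar R s :=
  match s return R -> scalar R s with
  | RealScalars => fun x => x
  | ComplexScalars => fun x => x%:C%C
  end.

Lemma sqr_norm_sconj z : `|z| ^+ 2 = z * sconj z.
Proof.
move: z; rewrite /scalar/sconj; case: s => /= z; last exact: sqr_normc.
by rewrite real_normK ?num_real// expr2.
Qed.

Lemma sconj_ge0 z : 0 <= z -> sconj z = z.
Proof.
move: z; rewrite /scalar/sconj; case: s => //= z /ger0_Im.
by case: z => a b /= ->; rewrite oppr0.
Qed.

Lemma sre_zmod_morphism : zmod_morphism (@sre R s).
Proof. by rewrite /scalar/sre; case: s => [x y|[a b] [c d]]. Qed.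
HB.instance Definition _ :=
  GRing.isZmodMorphism.Build (scalar R s) R (@sre R s) sre_zmod_morphism.

Lemma sre_le (z z' : scalar R s) : z <= z' -> sre z <= sre z'.
Proof.
move: z z'; rewrite /scalar/sre; case: s => //= z z'.
by rewrite lecE => /andP[].
Qed.

Lemma sre_ge0 z : 0 <= z -> 0 <= sre z.
Proof. by move=> /sre_le; rewrite raddf0. Qed.

Lemma sre_sqr_of_real (x : R) : sre (of_real x ^+ 2) = x ^+ 2.
Proof. by rewrite /sre/of_real; case: s; rewrite // !expr2 /= mulr0 subr0. Qed.

Lemma of_real_gt0 (x : R) : 0 < x -> 0 < of_real x.
Proof. by rewrite /scalar/of_real; case: s => //= x0; rewrite ltcR. Qed.

Lemma sre_gt0 z : 0 < z -> 0 < sre z.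
Proof.
move: z; rewrite /scalar/sre; case: s => //= z.
by rewrite ltcE => /andP[].
Qed.

(** Small quantities are compared with this sequence because it is the rate of
    convergence of the square root iteration below. *)
Lemma scalar_archi z : 0 < z -> exists n : nat, 2 / n.+2%:R <= z.
Proof.
move=> z0; have {z0} [x x0 zE] : exists2 x : R, 0 < x & z = of_real x.
  exists (sre z); first exact: sre_gt0.
  move: z z0; rewrite /scalar/sre/of_real; case: s => //= -[a b].
  by rewrite ltcE/= => /andP[/eqP->].
have [n nx] : exists n : nat, 2 / n.+2%:R <= x.
  exists (Num.bound (2 / x)); rewrite ler_pdivrMr// mulrC -ler_pdivrMr//.
  apply: (le_trans (ltW (archi_boundP _))); first by rewrite divr_ge0// ltW.
  by rewrite ler_nat; do 2 apply: leqW.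
exists n; rewrite zE; move: nx; rewrite /scalar/of_real; case: s => //=.
by rewrite -lecR rmorphM/= fmorphV !rmorph_nat.
Qed.

End Scalars.

Section InnerProduct.
Context {R : realType} {s : scalar_kind} {H : hilbert R s}.
Implicit Types (x y z : H) (a : scalar R s).

Lemma innerC x y : inner x y = sconj (inner y x).
Proof. by rewrite hermC /= expr0 mul1r. Qed.

Lemma innerZl a x y : inner (a *: x) y = a * inner x y.
Proof. by rewrite linearZl. Qed.

Lemma innerZr a x y : inner x (a *: y) = sconj a * inner x y.
Proof. by rewrite linearZr. Qed.

Lemma inner0l y : inner 0 y = 0. Proof. exact: linear0l. Qed.
Lemma inner0r x : inner x 0 = 0. Proof. exact: linear0r. Qed.

Lemma innerDl x y z : inner (x + y) z = inner x z + inner y z.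
Proof. exact: linearDl. Qed.

Lemma innerDr x y z : inner x (y + z) = inner x y + inner x z.
Proof. exact: linearDr. Qed.

Lemma innerBl x y z : inner (x - y) z = inner x z - inner y z.
Proof. exact: linearBl. Qed.

Lemma innerBr x y z : inner x (y - z) = inner x y - inner x z.
Proof. exact: linearBr. Qed.

Lemma inner_ge0 x : 0 <= inner x x.
Proof. by rewrite inner_norm exprn_ge0. Qed.

Lemma inner_eq0 x : inner x x = 0 -> x = 0.
Proof. by rewrite inner_norm => /eqP; rewrite expf_eq0 normr_eq0 => /eqP. Qed.

(** Turns an identity between vectors into one between scalars, where [ring]
    and [field] apply. *)
Lemma inner_inj x y : (forall z, inner x z = inner y z) -> x = y.
Proof.
move=> xy; apply/eqP; rewrite -subr_eq0; apply/eqP/inner_eq0.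
by rewrite {1}innerBl xy subrr.
Qed.

Lemma innerNl x y : inner (- x) y = - inner x y.
Proof. exact: linearNl. Qed.

Lemma inner_suml (I : Type) (r : seq I) (P : pred I) (f : I -> H) x :
  inner (\sum_(i <- r | P i) f i) x = \sum_(i <- r | P i) inner (f i) x.
Proof. exact: linear_sumlz. Qed.

Lemma inner_sumr (I : Type) (r : seq I) (P : pred I) (f : I -> H) x :
  inner x (\sum_(i <- r | P i) f i) = \sum_(i <- r | P i) inner x (f i).
Proof. exact: linear_sumr. Qed.

(** Expanding the squared norm of [<y,y> x - <x,y> y] gives the squared
    inequality multiplied by [<y,y>]. *)
Lemma cauchy_schwarz x y : `|inner x y| <= `|x| * `|y|.
Proof.
have [->|y0] := eqVneq y 0; first by rewrite inner0r !normr0 mulr0.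
have n0 : 0 < `|y| by rewrite normr_gt0.
rewrite -(@ler_pXn2r _ 2)// ?nnegrE ?mulr_ge0// sqr_norm_sconj -innerC exprMn.
have := inner_ge0 (inner y y *: x - inner x y *: y).
rewrite !(innerBl, innerBr) !innerZl !innerZr (sconj_ge0 (inner_ge0 y)) -innerC.
set p := inner y y; set q := inner x y * inner y x.
rewrite (_ : _ - _ = p * (p * inner x x - q)); last by rewrite /q /p; ring.
by rewrite pmulr_rge0 ?subr_ge0 /p !inner_norm ?exprn_gt0// mulrC.
Qed.

End InnerProduct.

(** * Square roots of positive operators *)

Section LinearMaps.
Context {R : realType} {s : scalar_kind} {H : hilbert R s}.
Implicit Types (A B : H -> H) (x y : H) (a : scalar R s).

Lemma lin0 A : linear A -> A 0 = 0.
Proof. by move=> lA; have := lA (-1) 0 0; rewrite addr0 scaler0 scaleN1r addNr. Qed.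

Lemma linZ A a x : linear A -> A (a *: x) = a *: A x.
Proof. by move=> lA; have := lA a x 0; rewrite (lin0 lA) !addr0. Qed.

Lemma linD A x y : linear A -> A (x + y) = A x + A y.
Proof. by move=> lA; have := lA 1 x y; rewrite !scale1r. Qed.

Lemma linB A x y : linear A -> A (x - y) = A x - A y.
Proof. by move=> lA; rewrite (linD _ _ lA) -scaleN1r (linZ _ _ lA) scaleN1r. Qed.

Lemma lin_comp A B : linear A -> linear B -> linear (A \o B).
Proof. by move=> lA lB a x y /=; rewrite lB lA. Qed.

End LinearMaps.

Section Gap.
Context {K : numFieldType}.

(** With q = 1 - gap, this is the recursion q_(n+1) = (1 + q_n^2) / 2, q_0 = 0,
    that is the square root iteration with the operator replaced by its norm
    bound 1. *)
Fixpoint gap n : K := if n is m.+1 then gap m - gap m ^+ 2 / 2 else 1.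

(** The map g |-> g - g^2/2 increases on [0,1] and sends 2/(n+2) below
    2/(n+3), so the bound propagates. *)
Lemma gap_bound n : 0 <= gap n <= 2 / n.+2%:R.
Proof.
elim: n => [|n /andP[g0 gb]]; first by rewrite /= divff ?ler01 ?lexx.
set b := 2 / n.+2%:R in gb; rewrite [gap n.+1]/=; set g := gap n in g0 gb *.
have b1 : b <= 1 by rewrite ler_pdivrMr// mul1r ler_nat.
have g1 : g <= 1 := le_trans gb b1.
have h0 (c : K) : c <= 1 + 1 -> 0 <= 1 - c / 2.
  by move=> c2; rewrite subr_ge0 ler_pdivrMr// mul1r.
apply/andP; split.
  rewrite (_ : _ - _ = g * (1 - g / 2)); last by field.
  by apply: mulr_ge0 => //; apply: h0; rewrite (le_trans g1)// lerDl.
apply: (@le_trans _ _ (b - b ^+ 2 / 2)).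
  rewrite -subr_ge0 (_ : _ - _ = (b - g) * (1 - (b + g) / 2)); last by field.
  by apply: mulr_ge0; [rewrite subr_ge0|apply: h0; rewrite lerD].
rewrite /b -[n.+3%:R]natr1 {b gb b1}.
have : 0 < n.+2%:R :> K by rewrite ltr0n.
move: (n.+2%:R : K) => u u0.
have u1 : 0 < u + 1 by rewrite addr_gt0.
rewrite -subr_ge0 (_ : _ - _ = 2 / (u ^+ 2 * (u + 1))).
  by rewrite divr_ge0// mulr_ge0 ?exprn_ge0 ?ltW.
have u0' : u != 0 by rewrite gt_eqF.
have u1' : u + 1 != 0 by rewrite gt_eqF.
by field; rewrite u0' u1'.
Qed.

Lemma gap_ge0 n : 0 <= gap n.
Proof. by case/andP: (gap_bound n). Qed.

Lemma gapS_le n : gap n.+1 <= gap n.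
Proof. by rewrite /= gerBl divr_ge0// exprn_ge0 ?gap_ge0. Qed.

Lemma gap_le1 n : gap n <= 1.
Proof. by elim: n => [//|n IH]; exact: le_trans (gapS_le n) IH. Qed.

End Gap.

Section SquareRootIteration.
Context {R : realType} {s : scalar_kind} {H : hilbert R s}.
Local Notation K := (scalar R s).
Local Notation gap := (@gap K).

Lemma gap_small (e : K) : 0 < e -> exists n, gap n <= e.
Proof.
move=> /scalar_archi[n ne]; exists n; apply: le_trans ne.
by case/andP: (@gap_bound K n).
Qed.

Lemma gap_eq0 (c : K) (x : H) : 0 <= c -> (forall n, `|x| <= gap n * c) -> x = 0.
Proof.
move=> c0 xc; apply/eqP; rewrite -normr_eq0 eq_le normr_ge0 andbT.
apply/ler_addgt0Pr => e e0; rewrite add0r.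
have c1 : 0 < c + 1 by rewrite ltr_wpDl.
have [n ne] := @gap_small (e / (c + 1)) (divr_gt0 e0 c1).
apply: (le_trans (xc n)).
apply: (@le_trans _ _ (e / (c + 1) * (c + 1))); last by rewrite divfK ?gt_eqF.
by apply: ler_pM; rewrite ?gap_ge0// lerDl.
Qed.

Variable T : H -> H.
Hypothesis linT : linear T.
Hypothesis symT : forall x y, inner (T x) y = inner x (T y).
Hypothesis conT : forall x, `|T x| <= `|x|.

(** The approximations Y_(n+1) = (T + Y_n^2) / 2 of 1 - sqrt(1 - T). *)
Fixpoint sqiter n : H -> H :=
  if n is m.+1 then fun x => 2^-1 *: (T x + sqiter m (sqiter m x))
  else fun=> 0.

Lemma sqiter_linear n : linear (sqiter n).
Proof.
elim: n => [|n IH] a x y /=; first by rewrite scaler0 addr0.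
rewrite linT !IH scalerA [a * _]mulrC -scalerA -scalerDr; congr (_ *: _).
by rewrite scalerDr addrACA.
Qed.

Lemma sqiter_sym n x y : inner (sqiter n x) y = inner x (sqiter n y).
Proof.
elim: n x y => [|n IH] x y /=; first by rewrite inner0l inner0r.
rewrite innerZl innerZr innerDl innerDr symT !IH sconj_ge0//.
Qed.

Lemma half_norm (x : H) : `|2^-1 *: x| = 2^-1 * `|x|.
Proof. by rewrite normrZ ger0_norm// invr_ge0. Qed.

Lemma sqiter_norm n x : `|sqiter n x| <= (1 - gap n) * `|x|.
Proof.
elim: n x => [|n IH] x; first by rewrite /= subrr mul0r normr0.
have q0 : 0 <= 1 - gap n by rewrite subr_ge0 gap_le1.
rewrite [sqiter _ _]/= half_norm.
have -> : (1 - gap n.+1) * `|x| = 2^-1 * (`|x| + (1 - gap n) ^+ 2 * `|x|).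
  by rewrite /=; field.
apply: ler_pM; rewrite ?invr_ge0//; apply: (le_trans (ler_normD _ _)).
apply: lerD; first exact: conT.
by apply: (le_trans (IH _)); rewrite expr2 -mulrA; apply: ler_pM.
Qed.

Lemma sqiter_norm_le n x : `|sqiter n x| <= `|x|.
Proof.
apply: (le_trans (sqiter_norm _ _)); rewrite ler_piMl//.
by rewrite gerBl gap_ge0.
Qed.

(** Since 2(Y_(n+2) - Y_(n+1)) = (Y_(n+1) - Y_n) Y_(n+1) + Y_n (Y_(n+1) - Y_n),
    the increments are dominated by those of the scalar iteration. *)
Lemma sqiter_step n x :
  `|sqiter n.+1 x - sqiter n x| <= (gap n - gap n.+1) * `|x|.
Proof.
elim: n x => [|n IH] x.
  rewrite /= subr0 addr0 half_norm (_ : 1 - _ = 2^-1); last by field.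
  by apply: ler_pM; rewrite ?invr_ge0.
set Y := sqiter n; set Z := sqiter n.+1.
have -> : sqiter n.+2 x - Z x = 2^-1 *: ((Z (Z x) - Y (Z x)) + Y (Z x - Y x)).
  rewrite linB; last exact: sqiter_linear.
  by rewrite addrA subrK [Z x in LHS]/= -scalerBr opprD addrACA subrr add0r.
have d0 : 0 <= gap n - gap n.+1 by rewrite subr_ge0 gapS_le.
have q0 m : 0 <= 1 - gap m by rewrite subr_ge0 gap_le1.
have -> : (gap n.+1 - gap n.+2) * `|x| = 2^-1 *
    ((gap n - gap n.+1) * ((1 - gap n.+1) * `|x|) +
     (1 - gap n) * ((gap n - gap n.+1) * `|x|)) by rewrite /=; field.
rewrite half_norm.
apply: ler_pM; rewrite ?invr_ge0//; apply: (le_trans (ler_normD _ _)).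
apply: lerD.
  by apply: (le_trans (IH _)); apply: ler_pM => //; exact: sqiter_norm.
by apply: (le_trans (sqiter_norm _ _)); apply: ler_pM.
Qed.

Lemma sqiter_dist n k x : `|sqiter (n + k) x - sqiter n x| <= gap n * `|x|.
Proof.
suff: `|sqiter (n + k) x - sqiter n x| <= (gap n - gap (n + k)) * `|x|.
  move/le_trans; apply; apply: ler_wpM2r => //.
  by rewrite gerBl gap_ge0.
elim: k => [|k IH]; first by rewrite addn0 !subrr mul0r normr0.
rewrite addnS -(subrKA (sqiter (n + k) x)); apply: (le_trans (ler_normD _ _)).
apply: (le_trans (lerD (sqiter_step _ _) IH)).
by rewrite -mulrDl addrC subrKA.
Qed.

Lemma sqiter_limit x : exists y, forall n, `|y - sqiter n x| <= gap n * `|x|.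
Proof.
have /cauchy_cvgP/cvg_ex[y yx] : cauchy (sqiter n x @[n --> \oo]).
  apply: cauchy_exP => e e0.
  have [n ne] := gap_small (divr_gt0 e0 (ltr_wpDl (normr_ge0 x) (@ltr01 K))).
  exists (sqiter n x); exists n => // m /= nm.
  rewrite -ball_normE /= distrC -(subnKC nm).
  apply: (le_lt_trans (sqiter_dist _ _ _)).
  have x1 : 0 < `|x| + 1 by rewrite ltr_wpDl.
  apply: (@le_lt_trans _ _ (e / (`|x| + 1) * `|x|)); first exact: ler_wpM2r.
  by rewrite mulrAC ltr_pdivrMr// ltr_pM2l// ltrDl.
exists y => n; apply/ler_addgt0Pr => e e0.
have /cvgrPdist_le/(_ e e0)[N _ yN] := yx.
rewrite -(subrKA (sqiter (n + N) x)) addrC; apply: (le_trans (ler_normD _ _)).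
by apply: lerD; [exact: sqiter_dist|apply: yN; rewrite /= leq_addl].
Qed.

(** The limit of the iteration solves 2Y = T + Y^2, that is
    (1 - Y)^2 = 1 - T. Every clause passes to the limit because the iterates
    converge at the rate [gap], uniformly on bounded sets. *)
Lemma contraction_quadratic : exists Y : H -> H,
  [/\ linear Y, forall x y, inner (Y x) y = inner x (Y y),
      forall x, `|Y x| <= `|x| & forall x, Y x + Y x = T x + Y (Y x)].
Proof.
have [Y YE] := choice sqiter_limit.
have linY : linear Y.
  move=> a x y; apply/eqP; rewrite -subr_eq0; apply/eqP.
  apply: (@gap_eq0 (`|a *: x + y| + `|a| * `|x| + `|y|)).
    by rewrite !addr_ge0 ?mulr_ge0.
  move=> n; pose D z := Y z - sqiter n z.
  have -> : Y (a *: x + y) - (a *: Y x + Y y)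
            = D (a *: x + y) - a *: D x - D y.
    apply: inner_inj => z; rewrite /D sqiter_linear.
    by rewrite !(innerBl, innerDl, innerZl); ring.
  rewrite !mulrDr; apply: (le_trans (ler_normB _ _)).
  apply: lerD; last exact: YE.
  apply: (le_trans (ler_normB _ _)); apply: lerD; first exact: YE.
  by rewrite normrZ mulrCA; apply: ler_wpM2l (YE _ _).
exists Y; split=> // [x y|x|x].
- apply/eqP; rewrite -subr_eq0 -normr_eq0 eq_le normr_ge0 andbT.
  apply/ler_addgt0Pr => e e0; rewrite add0r.
  have c0 : 0 < `|x| * `|y| + `|x| * `|y| + 1.
    by rewrite ltr_wpDl ?addr_ge0 ?mulr_ge0.
  have [n ne] := gap_small (divr_gt0 e0 c0).
  have -> : inner (Y x) y - inner x (Y y)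
     = inner (Y x - sqiter n x) y - inner x (Y y - sqiter n y).
    by rewrite innerBl innerBr sqiter_sym; ring.
  apply: (le_trans (ler_normB _ _)).
  apply: (@le_trans _ _ (gap n * (`|x| * `|y| + `|x| * `|y|))).
    rewrite mulrDr; apply: lerD; apply: (le_trans (cauchy_schwarz _ _)).
      by rewrite mulrA; apply: ler_wpM2r (YE _ _).
    by rewrite mulrCA; apply: ler_wpM2l (YE _ _).
  apply: (@le_trans _ _ (e / (`|x| * `|y| + `|x| * `|y| + 1) *
                         (`|x| * `|y| + `|x| * `|y|))).
    by apply: ler_wpM2r => //; rewrite addr_ge0 ?mulr_ge0.
  by rewrite mulrAC ler_pdivrMr// ler_pM2l// lerDl.
(* The zeroth iterate is 0 and its gap is 1. *)
- rewrite -(subrK (sqiter 0 x) (Y x)).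
  by rewrite addr0; have := YE x 0; rewrite mul1r.
- apply/eqP; rewrite -subr_eq0; apply/eqP.
  apply: (@gap_eq0 (`|x| + `|x| + `|x| + `|x|)); first by rewrite !addr_ge0.
  move=> n; pose S := sqiter n.
  (* The recursion for the iterates cancels everything but the errors. *)
  have -> : Y x + Y x - (T x + Y (Y x)) = (Y x - sqiter n.+1 x)
     + (Y x - sqiter n.+1 x) - S (Y x - S x) - (Y (Y x) - S (Y x)).
    rewrite /S /= (linB _ _ (sqiter_linear n)); apply: inner_inj => z.
    by rewrite !(innerBl, innerDl, innerZl); field.
  rewrite !mulrDr.
  have step : `|Y x - sqiter n.+1 x| <= gap n * `|x|.
    by apply: (le_trans (YE _ _)); apply: ler_wpM2r => //; exact: gapS_le.
  have Yn z : `|Y z| <= `|z|.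
    rewrite -(subrK (sqiter 0 z) (Y z)).
    by rewrite addr0; have := YE z 0; rewrite mul1r.
  apply: (le_trans (ler_normB _ _)); apply: lerD.
    apply: (le_trans (ler_normB _ _)); apply: lerD.
      by apply: (le_trans (ler_normD _ _)); apply: lerD.
    exact: le_trans (sqiter_norm_le _ _) (YE _ _).
  by apply: (le_trans (YE _ _)); apply: ler_wpM2l => //; exact: gap_ge0.
Qed.


End SquareRootIteration.

Section PositiveOperators.
Context {R : realType} {s : scalar_kind} {H : hilbert R s}.
Implicit Types (A B P Q S : H -> H) (x y : H).

(** A bound that is positive; the one given by [bounded_op] could be any scalar
    on the zero space. *)
Lemma bounded_opP A : bounded_op A <->
  linear A /\ exists2 M : scalar R s, 0 < M & forall x, `|A x| <= M * `|x|.
Proof.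
split=> -[lA]; last by move=> [M _ AM]; split=> //; exists M.
move=> [M AM]; split=> //; exists (`|M| + 1); first by rewrite ltr_wpDl.
move=> x; have [->|x0] := eqVneq x 0.
  by rewrite (lin0 lA) normr0 mulr0.
have n0 : 0 < `|x| by rewrite normr_gt0.
apply: (le_trans (AM x)); rewrite ler_pM2r//.
have M0 : 0 <= M by rewrite -(pmulr_lge0 _ n0) (le_trans _ (AM x)).
by rewrite ger0_norm// lerDl.
Qed.

Lemma bounded_comp A B : bounded_op A -> bounded_op B -> bounded_op (A \o B).
Proof.
move=> /bounded_opP[lA [M M0 AM]] /bounded_opP[lB [M' M'0 BM]].
split; first exact: lin_comp.
exists (M * M') => x /=; apply: (le_trans (AM _)).
by rewrite -mulrA ler_pM2l.
Qed.

Lemma positive_sandwich S Q :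
  positive_op S -> positive_op Q -> positive_op (S \o Q \o S).
Proof.
move=> [bS symS _] [bQ symQ posQ]; split.
- by apply: bounded_comp => //; apply: bounded_comp.
- by move=> x y /=; rewrite symS symQ symS.
- by move=> x /=; rewrite symS.
Qed.

(** Evaluate the form of A at x - Ax/M and bound <A(Ax),Ax> by M <Ax,Ax>. *)
Lemma positive_normsq A (M : scalar R s) : positive_op A -> 0 < M ->
    (forall x, `|A x| <= M * `|x|) ->
  forall x, inner (A x) (A x) <= M * inner (A x) x.
Proof.
move=> [[lA _] symA posA] M0 AM x.
have := posA (x - M^-1 *: A x).
have AAx : inner (A (A x)) (A x) <= M * inner (A x) (A x).
  have /ger0_norm <- := posA (A x); apply: (le_trans (cauchy_schwarz _ _)).
  by rewrite inner_norm expr2 mulrA ler_wpM2r.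
rewrite (linB _ _ lA) (linZ _ _ lA) !(innerBl, innerBr) !innerZl !innerZr.
have MV : 0 <= M^-1 by rewrite invr_ge0 ltW.
rewrite (sconj_ge0 MV) (symA (A x) x) => pos.
have M1 : M != 0 by rewrite gt_eqF.
have alg (K : numFieldType) (m p q r : K) : m != 0 ->
    m * p - q = m * (p - m^-1 * q - (m^-1 * q - m^-1 * (m^-1 * r)))
                + m^-1 * (m * q - r).
  by move=> m0; field.
rewrite -subr_ge0 (alg _ _ _ _ (inner (A (A x)) (A x)) M1).
by apply: addr_ge0; apply: mulr_ge0; rewrite ?(ltW M0)// subr_ge0.
Qed.

(** Scale A so that T = 1 - A/c^2 is a contraction; then B = c(1 - Y), with Y
    solving 2Y = T + Y^2, squares to A. *)
Lemma op_sqrt_exists A :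
  positive_op A -> exists B, positive_op B /\ B \o B = A.
Proof.
move=> posA; have [/bounded_opP[lA [M M0 AM]] symA pA] := posA.
pose c := M + 1; have c0 : 0 < c by rewrite addr_gt0.
have cA x : `|A x| <= c ^+ 2 * `|x|.
  apply: (le_trans (AM x)); apply: ler_wpM2r => //.
  rewrite -subr_ge0 (_ : _ - _ = M ^+ 2 + M + 1); last by rewrite /c; ring.
  by rewrite !addr_ge0// ?exprn_ge0// ltW.
have c20 : 0 < c ^+ 2 by rewrite exprn_gt0.
have c1 : c != 0 by rewrite gt_eqF.
have ci0 : 0 <= c^-1 ^+ 2 by rewrite exprn_ge0// invr_ge0 ltW.
pose T x := x - c^-1 ^+ 2 *: A x.
have [||x|Y [lY symY conY YE]] := @contraction_quadratic R s H T.
- move=> a x y; rewrite /T lA; apply: inner_inj => z.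
  by rewrite !(innerBl, innerDl, innerZl); ring.
- move=> x y; rewrite /T !(innerBl, innerBr) innerZl innerZr symA.
  by rewrite (sconj_ge0 ci0).
(* |Tx|^2 = |x|^2 - 2<Ax,x>/c^2 + |Ax|^2/c^4, and |Ax|^2 <= c^2 <Ax,x>. *)
- rewrite -(@ler_pXn2r _ 2)// ?nnegrE// -!inner_norm /T.
  rewrite !(innerBl, innerBr) !innerZl !innerZr (sconj_ge0 ci0) -(symA x x).
  have nx := positive_normsq posA c20 cA x.
  have alg (K : numFieldType) (k p q r : K) : k != 0 ->
      p - (p - k^-1 ^+ 2 * q - (k^-1 ^+ 2 * q - k^-1 ^+ 2 * (k^-1 ^+ 2 * r)))
      = k^-1 ^+ 2 * q + (k^-1 ^+ 2) ^+ 2 * (k ^+ 2 * q - r).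
    by move=> k0; field.
  rewrite -subr_ge0 alg//.
  by apply: addr_ge0; apply: mulr_ge0; rewrite ?subr_ge0// exprn_ge0.
pose B x := c *: (x - Y x).
have lB : linear B.
  move=> a x y; rewrite /B lY; apply: inner_inj => z.
  by rewrite !(innerZl, innerBl, innerDl); ring.
exists B; split; last first.
  apply/funext => x /=; rewrite /B (linZ _ _ lY) (linB _ _ lY).
  apply: inner_inj => z; rewrite !(innerZl, innerBl).
  have := congr1 (inner^~ z) (YE x); rewrite /T !(innerDl, innerNl, innerZl) => E.
  have -> : inner (Y (Y x)) z
    = inner (Y x) z + inner (Y x) z - inner x z + c^-1 ^+ 2 * inner (A x) z.
    by rewrite E; ring.
  have alg (K : numFieldType) (k p q r : K) : k != 0 ->
      k * (k * (p - q) - k * (q - (q + q - p + k^-1 ^+ 2 * r))) = r.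
    by move=> k0; field.
  exact: alg.
split.
- split=> //; exists (c + c) => x.
  rewrite /B normrZ (ger0_norm (ltW c0)) -mulr2n -mulr_natl -mulrA mulrCA.
  rewrite ler_pM2l//; apply: (le_trans (ler_normB _ _)).
  by rewrite mulr_natl mulr2n lerD.
- move=> x y; rewrite /B innerZl innerZr (sconj_ge0 (ltW c0)).
  by rewrite innerBl innerBr symY.
(* Polarization: 2<x - Yx, x> = |x|^2 - |Yx|^2 + |x - Yx|^2. *)
- move=> x; rewrite /B innerZl mulr_ge0 ?(ltW c0)//.
  have -> : inner (x - Y x) x = 2^-1 * (inner x x - inner (Y x) (Y x) +
     inner (x - Y x) (x - Y x)).
    by rewrite !(innerBl, innerBr) symY; field.
  rewrite mulr_ge0 ?invr_ge0// addr_ge0 ?inner_ge0//.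
  by rewrite subr_ge0 !inner_norm; apply: lerXn2r; rewrite ?nnegrE.
Qed.

Lemma op_sqrtP A :
  positive_op A -> positive_op (op_sqrt A) /\ op_sqrt A \o op_sqrt A = A.
Proof. by move=> /op_sqrt_exists; exact: xgetPex. Qed.

End PositiveOperators.

(** * Hilbert-Schmidt norms *)

Section Parseval.
Context {R : realType} {s : scalar_kind} {H : hilbert R s}.
Implicit Types (E : set H) (x y e : H) (F : {fset H}).

Definition orthonormal E : Prop :=
  forall e e', E e -> E e' -> inner e e' = (e == e')%:R.

(** Completing the square: the Fourier coefficients are the best ones, which
    yields both the Bessel inequality and the lower bound in the Parseval
    identity. *)
Lemma approximation_error E F x (c : H -> scalar R s) :
    orthonormal E -> [set` F] `<=` E ->
  `|x - \sum_(e <- F) c e *: e| ^+ 2 =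
  `|x| ^+ 2 - \sum_(e <- F) `|inner x e| ^+ 2
  + \sum_(e <- F) `|inner x e - c e| ^+ 2.
Proof.
move=> oE FE; rewrite -!inner_norm innerBl !innerBr.
rewrite inner_sumr [inner (\sum_(_ <- _) _) x]inner_suml inner_suml.
have -> : \sum_(e <- F) inner (c e *: e) (\sum_(f <- F) c f *: f)
  = \sum_(e <- F) c e * sconj (c e).
  apply: eq_big_seq => e eF; rewrite innerZl inner_sumr (bigD1_seq e)//=.
  rewrite innerZr oE ?eqxx ?mulr1; try exact: FE.
  rewrite big_seq_cond big1 ?addr0// => f /andP[fF fe].
  by rewrite innerZr oE ?(eq_sym e) ?(negPf fe) ?mulr0//; exact: FE.
rewrite opprB -addrA -[in RHS]addrA; congr (_ + _).
rewrite -!sumrN -!big_split/=; apply: eq_bigr => e _.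
rewrite !sqr_norm_sconj innerZr innerZl (innerC e x) !rmorphB/=; ring.
Qed.

Lemma bessel E F x : orthonormal E -> [set` F] `<=` E ->
  \sum_(e <- F) `|inner x e| ^+ 2 <= `|x| ^+ 2.
Proof.
move=> oE FE; have := approximation_error x (inner x) oE FE.
rewrite [X in _ = _ + X]big1 ?addr0; last by move=> e _; rewrite subrr normr0 expr0n.
by rewrite -subr_ge0 => <-; rewrite exprn_ge0.
Qed.

(** By density some finite combination is close to x; by [approximation_error]
    the Fourier coefficients along the same vectors do at least as well. *)
Lemma parseval E x : orthonormal_basis E ->
  (sre (`|x| ^+ 2))%:E = \esum_(e in E) (sre (`|inner x e| ^+ 2))%:E.
Proof.
move=> [oE dE]; apply/eqP; rewrite eq_le; apply/andP; split; last first.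
  apply: ge_ereal_sup => _ [F [finF FE] <-].
  rewrite fsbig_finite//= sumEFin lee_fin -raddf_sum.
  by apply/sre_le/(bessel _ oE) => e /=; rewrite in_fset_set// inE => /FE.
apply/lee_addgt0Pr => e e0.
have d0 : 0 < Num.min e 1 by rewrite lt_min e0 ltr01.
have : closure [set x : H | exists (F : {fset H}) (c : H -> scalar R s),
    [set` F] `<=` E /\ x = \sum_(e <- F) c e *: e] x by rewrite dE.
move=> /(_ _ (nbhsx_ballx x _ (of_real_gt0 d0))).
move=> [y [[F [c [FE ->]]]]]; rewrite -ball_normE /= => /ltW xy.
have : `|x - \sum_(e <- F) c e *: e| ^+ 2 <= of_real (Num.min e 1) ^+ 2.
  by apply: lerXn2r; rewrite ?nnegrE// ltW// of_real_gt0.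
rewrite (approximation_error _ _ oE FE) => /sre_le.
rewrite raddfD raddfB/= sre_sqr_of_real => xe.
have s0 : 0 <= sre (\sum_(e <- F) `|inner x e - c e| ^+ 2).
  by apply: sre_ge0; rewrite sumr_ge0// => i _; rewrite exprn_ge0.
have me : Num.min e 1 ^+ 2 <= e.
  rewrite expr2 (@le_trans _ _ (Num.min e 1 * 1))//.
    by rewrite ler_pM2l// ge_min lexx orbT.
  by rewrite mulr1 ge_min lexx.
apply: (@le_trans _ _ ((sre (\sum_(e <- F) `|inner x e| ^+ 2))%:E + e%:E)%E).
  by rewrite lee_fin; lra.
apply: leeD => //; apply: esum_ge; exists [set` F]; first by split.
by rewrite fsbig_finite// set_fsetK sumEFin raddf_sum.
Qed.

End Parseval.

Section SchurProduct.
Context {R : realType} {s : scalar_kind} {H : hilbert R s}.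

(** Schur product theorem for Gram matrices, by induction on the family of
    indices. Subtracting from each v_i its component along v_k splits the
    second Gram matrix into the one of the family v', whose index k can be
    dropped because v'_k = 0, and the rank one matrix p c_i conj(c_j), which
    turns the sum into p |sum conj(c_i) u_i|^2. *)
Lemma schur_product_ge0 (I : Type) (r : seq I) (u v : I -> H) :
  0 <= \sum_(i <- r) \sum_(j <- r)
         inner (u i) (u j) * sconj (inner (v i) (v j)).
Proof.
elim: r v => [|k r IH] v; first by rewrite big_nil.
pose p := inner (v k) (v k); pose c i := inner (v i) (v k) / p.
pose v' i := v i - c i *: v k.
have p0 : 0 <= p := inner_ge0 _.
have v'k : v' k = 0.
  rewrite /v' /c; have [/inner_eq0->|pN0] := eqVneq p 0.
    by rewrite scaler0 subr0.
  by rewrite divff// scale1r subrr.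
(* When p = 0 the quotient c is 0, which is correct since then v_k = 0. *)
have cE i : c i * p = inner (v i) (v k).
  rewrite /c; have [pE|pN0] := eqVneq p 0; last by rewrite divfK.
  by rewrite pE mulr0 (inner_eq0 pE) inner0r.
have v'v i : inner (v' i) (v k) = 0 by rewrite innerBl innerZl cE subrr.
have vD i : v i = v' i + c i *: v k by rewrite subrK.
clearbody v'.
have vE i j : inner (v i) (v j) =
    inner (v' i) (v' j) + p * (c i * sconj (c j)).
  rewrite {1}(vD i) {1}(vD j) innerDl !innerDr !innerZr !innerZl v'v (innerC (v k)) v'v -/p.
  by rewrite rmorph0; ring.
under eq_bigr do under eq_bigr do rewrite vE rmorphD mulrDr.
under eq_bigr do rewrite big_split/=.
rewrite big_split/= addr_ge0//.
  rewrite big_cons big1 ?add0r; last by move=> j _; rewrite v'k inner0l rmorph0 mulr0.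
  under eq_bigr do rewrite big_cons v'k inner0r rmorph0 mulr0 add0r.
  exact: IH.
have := mulr_ge0 p0 (inner_ge0 (\sum_(i <- k :: r) sconj (c i) *: u i)).
rewrite inner_suml mulr_sumr; congr (_ <= _); apply: eq_bigr => i _.
rewrite inner_sumr mulr_sumr; apply: eq_bigr => j _.
by rewrite innerZl innerZr !rmorphM/= !sconjK (sconj_ge0 p0); ring.
Qed.

(** The cross terms of |x + y|^2 are Schur products of positive kernels; the
    square roots of X and Y exhibit these kernels as Gram matrices. *)
Lemma positive_kernel_superadditive (X Y : H -> H) (r : seq H) :
    positive_op X -> positive_op Y ->
  \sum_(e <- r) \sum_(f <- r) (`|inner (X e) f| ^+ 2 + `|inner (Y e) f| ^+ 2)
  <= \sum_(e <- r) \sum_(f <- r) `|inner (X e + Y e) f| ^+ 2.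
Proof.
have gram (Z : H -> H) e f : positive_op Z ->
    inner (Z e) f = inner (op_sqrt Z e) (op_sqrt Z f).
  move=> /op_sqrtP[[_ symS _] SS].
  by move: (congr1 (@^~ e) SS) => /= <-; exact: symS.
move=> pX pY.
have cross (A B : H -> H) : positive_op A -> positive_op B ->
    0 <= \sum_(e <- r) \sum_(f <- r) inner (A e) f * sconj (inner (B e) f).
  move=> pA pB; have := schur_product_ge0 r (op_sqrt A) (op_sqrt B).
  congr (_ <= _); apply: eq_bigr => e _; apply: eq_bigr => f _.
  by rewrite (gram A _ _ pA) (gram B _ _ pB).
rewrite -subr_ge0 -sumrB; under eq_bigr do rewrite -sumrB.
have := addr_ge0 (cross _ _ pX pY) (cross _ _ pY pX).
congr (_ <= _); rewrite -big_split; apply: eq_bigr => e _.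
rewrite -big_split; apply: eq_bigr => f _ /=.
by rewrite !sqr_norm_sconj innerDl rmorphD/=; ring.
Qed.

End SchurProduct.

Section HilbertSchmidt.
Context {R : realType} {s : scalar_kind} {H : hilbert R s}.
Implicit Types (E : set H) (A X Y : H -> H).

Definition hs_sqr E A : \bar R :=
  \esum_(e in E) (sre (inner (A e) (A e)))%:E.

Lemma sre_inner_ge0 (x : H) : (0 <= (sre (inner x x))%:E)%E.
Proof. by rewrite lee_fin sre_ge0// inner_ge0. Qed.

Lemma hs_sqr_ge0 E A : (0 <= hs_sqr E A)%E.
Proof. by apply: esum_ge0 => e _; exact: sre_inner_ge0. Qed.

Lemma sqr_hs_norm E A : (hs_norm E A ^+ 2)%E = hs_sqr E A.
Proof. by rewrite /hs_norm sqr_sqrte// hs_sqr_ge0. Qed.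

Lemma hs_norm_le E A B : (hs_norm E A <= hs_norm E B)%E ->
  (hs_sqr E A <= hs_sqr E B)%E.
Proof. by rewrite /hs_norm lee_sqrt// hs_sqr_ge0. Qed.

(** This replaces tr((X + Y)^2) = tr X^2 + 2 tr(XY) + tr Y^2 with tr(XY) >= 0.
    By the Parseval identity the sums run over all matrix entries, and finite
    square blocks of entries suffice, on which the kernel inequality applies. *)
Lemma hs_sqr_superadditive E X Y : orthonormal_basis E ->
    positive_op X -> positive_op Y ->
  (hs_sqr E X + hs_sqr E Y <= hs_sqr E (X \+ Y)%R)%E.
Proof.
move=> bE pX pY; have [oE _] := bE.
pose g e f : R := sre (`|inner (X e) f| ^+ 2 + `|inner (Y e) f| ^+ 2).
have g0 e f : (0 <= (g e f)%:E)%E.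
  by rewrite lee_fin sre_ge0// addr_ge0// exprn_ge0.
have -> : (hs_sqr E X + hs_sqr E Y =
           \esum_(e in E) \esum_(f in E) (g e f)%:E)%E.
  rewrite -esumD; try by move=> *; exact: sre_inner_ge0.
  apply: eq_esum => e _; rewrite !inner_norm !(parseval _ bE) -esumD.
  - by apply: eq_esum => f _; rewrite /g raddfD EFinD.
  - by move=> f _; rewrite lee_fin sre_ge0// exprn_ge0.
  - by move=> f _; rewrite lee_fin sre_ge0// exprn_ge0.
apply: ge_ereal_sup => _ [F1 [finF1 F1E] <-].
rewrite fsbig_finite//= -esum_sum//.
apply: ge_ereal_sup => _ [F2 [finF2 F2E] <-].
rewrite fsbig_finite//=.
have finF : finite_set (F1 `|` F2) by rewrite finite_setU.
pose F := fset_set (F1 `|` F2).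
have FE : [set` F] `<=` E.
  by move=> e; rewrite /F fset_setK//= => -[/F1E|/F2E].
have sub1 : {subset fset_set F1 <= F}.
  by move=> e; rewrite !in_fset_set// !inE; left.
have sub2 : {subset fset_set F2 <= F}.
  by move=> e; rewrite !in_fset_set// !inE; right.
apply: (@le_trans _ _ (\sum_(f <- F) \sum_(e <- F) (g e f)%:E)%E).
  apply: (@le_trans _ _ (\sum_(f <- F) \sum_(e <- fset_set F1) (g e f)%:E)%E).
    by apply: lee_sum_nneg_subfset => // f _ _; rewrite sume_ge0.
  by apply: lee_sum => f _; apply: lee_sum_nneg_subfset.
rewrite exchange_big/=.
apply: (@le_trans _ _ (\sum_(e <- F) (sre (inner (X e + Y e)%R (X e + Y e)%R))%:E)%E).
  under eq_bigr do rewrite sumEFin.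
  rewrite !sumEFin lee_fin -!raddf_sum/=.
  under eq_bigr do rewrite -raddf_sum/=.
  rewrite -!raddf_sum; apply: sre_le.
  apply: (le_trans (positive_kernel_superadditive F pX pY)).
  by apply: ler_sum => e _; rewrite inner_norm; exact: bessel oE FE.
apply: esum_ge; exists [set` F]; first by split.
by rewrite fsbig_finite// set_fsetK.
Qed.

End HilbertSchmidt.

(** * Orthogonal projections *)

Section OrthogonalProjections.
Context {R : realType} {s : scalar_kind} {H : hilbert R s}.
Implicit Types (V : set H) (x y p q : H).

Definition projection_of V x p : Prop :=
  V p /\ forall y, V y -> inner (x - p) y = 0.

Lemma closed_subspaceB V x y : closed_subspace V -> V x -> V y -> V (x - y).
Proof.
by move=> [_ VD _] Vx Vy; rewrite addrC -scaleN1r; exact: VD.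
Qed.

Lemma projection_unique V x p q : closed_subspace V ->
  projection_of V x p -> projection_of V x q -> p = q.
Proof.
move=> cV [Vp xp] [Vq xq]; apply/eqP; rewrite -subr_eq0; apply/eqP.
apply: inner_eq0; have Vpq := closed_subspaceB cV Vp Vq.
have {1}-> : p - q = (x - q) - (x - p).
  by apply: inner_inj => z; rewrite !innerBl; ring.
by rewrite innerBl xp// xq// subrr.
Qed.

Lemma orth_projE V x p : closed_subspace V ->
  projection_of V x p -> orth_proj V x = p.
Proof.
by move=> cV xp; apply: (projection_unique cV _ xp); exact: xgetI xp.
Qed.

Variable V : set H.
Hypothesis cV : closed_subspace V.
Hypothesis exV : forall x, exists p, projection_of V x p.
Local Notation P := (orth_proj V).

Lemma orth_projP x : projection_of V x (P x).
Proof. exact: xgetPex (exV x). Qed.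

Lemma orth_proj_linear : linear P.
Proof.
move=> a x y; apply: orth_projE => //; have [_ VD _] := cV.
have [[Vx ox] [Vy oy]] := (orth_projP x, orth_projP y).
split; first exact: VD.
move=> z Vz; have -> : a *: x + y - (a *: P x + P y) = a *: (x - P x) + (y - P y).
  by apply: inner_inj => t; rewrite !(innerBl, innerDl, innerZl); ring.
by rewrite innerDl innerZl ox// oy// mulr0 addr0.
Qed.

Lemma orth_proj_innerl x y : inner (P x) y = inner (P x) (P y).
Proof.
have [Vx _] := orth_projP x; have [_ /(_ _ Vx)] := orth_projP y.
rewrite innerBl => /eqP; rewrite subr_eq0 => /eqP yx.
by rewrite innerC yx -innerC.
Qed.

Lemma orth_proj_innerr x y : inner x (P y) = inner (P x) (P y).
Proof. by rewrite innerC orth_proj_innerl -innerC. Qed.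

Lemma orth_proj_compl_inner x : inner (x - P x) x = inner (x - P x) (x - P x).
Proof.
rewrite [RHS]innerBr; have [Vx _] := orth_projP x.
by have [_ /(_ _ Vx) ->] := orth_projP x; rewrite subr0.
Qed.

Lemma norm_sqr_orth_proj x :
  inner x x = inner (P x) (P x) + inner (x - P x) (x - P x).
Proof. by rewrite -orth_proj_compl_inner innerBl (orth_proj_innerl x x) addrC subrK. Qed.

Lemma norm_le_of_inner x y : inner x x <= inner y y -> `|x| <= `|y|.
Proof. by rewrite !inner_norm ler_pXn2r ?nnegrE. Qed.

Lemma orth_proj_positive : positive_op P.
Proof.
split.
- split; first exact: orth_proj_linear.
  exists 1 => x; rewrite mul1r; apply: norm_le_of_inner.
  by rewrite [leRHS]norm_sqr_orth_proj lerDl inner_ge0.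
- by move=> x y; rewrite [LHS]orth_proj_innerl [RHS]orth_proj_innerr.
- by move=> x; rewrite orth_proj_innerl inner_ge0.
Qed.

Lemma orth_proj_compl_positive : positive_op (fun x => x - P x).
Proof.
split.
- split.
    move=> a x y; rewrite orth_proj_linear; apply: inner_inj => t.
    by rewrite !(innerBl, innerDl, innerZl); ring.
  exists 1 => x; rewrite mul1r; apply: norm_le_of_inner.
  by rewrite [leRHS]norm_sqr_orth_proj lerDr inner_ge0.
- by move=> x y; rewrite innerBl innerBr orth_proj_innerl (orth_proj_innerr x y).
- by move=> x; rewrite orth_proj_compl_inner inner_ge0.
Qed.

End OrthogonalProjections.

(** * Partitions of the tree and orthogonal decompositions *)

Section Depth.
Context {T : rooted_tree}.
Implicit Types v w : T.

Lemma depth_reach w : iter (depth w) (@parent T) w = root T.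
Proof. by rewrite /depth; case: ex_minnP => m /eqP. Qed.

Lemma depth_min w n : iter n (@parent T) w = root T -> (depth w <= n)%N.
Proof. by move=> /eqP wn; rewrite /depth; case: ex_minnP => m _; exact. Qed.

(** The convention that the root is its own parent agrees with truncated
    predecessor at depth 0. *)
Lemma depth_parent w : depth (parent w) = (depth w).-1.
Proof.
apply/eqP; rewrite eqn_leq; apply/andP; split.
  apply: depth_min; have := depth_reach w; case: (depth w) => [/= ->|n].
    exact: parent_root.
  by rewrite iterSr.
have : (depth w <= (depth (parent w)).+1)%N.
  by apply: depth_min; rewrite iterSr depth_reach.
by case: (depth w).
Qed.

Lemma depth_iter_parent w n : depth (iter n (@parent T) w) = (depth w - n)%N.
Proof. by elim: n => [|n IH] /=; rewrite ?subn0// depth_parent IH subnS. Qed.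

Lemma depth_child v w : v \in children w -> (depth v <= (depth w).+1)%N.
Proof.
rewrite childrenP => /andP[_ /eqP <-].
by apply: depth_min; rewrite iterSr depth_reach.
Qed.

End Depth.

Section Decompositions.
Context {R : realType} {s : scalar_kind} {H : hilbert R s} {T : rooted_tree}.
Variable W : T -> set H.
Hypothesis tW : subspace_tree W.
Implicit Types (x y : H) (v w : T) (A L : {fset T}).

Let closedW w : closed_subspace (W w). Proof. by case: tW. Qed.

Let W0 w : W w 0. Proof. by case: (closedW w). Qed.

(** Membership in the sum of the [W w] over a finite set of nodes, with an
    ordinary finite sum in place of a finitely supported one. *)
Definition decomposes L x : Prop := exists f : T -> H,
  (forall w, w \in L -> W w (f w)) /\ x = \sum_(w <- L) f w.

Lemma orthogonal_sum_fset L (V : set H) : orthogonal_sum [set` L] W V <->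
  (forall v w, v \in L -> w \in L -> v <> w ->
     forall x y, W v x -> W w y -> inner x y = 0) /\
  V = [set x | decomposes L x].
Proof.
rewrite /orthogonal_sum; have -> : [set x | exists f : T -> H,
    (forall i, [set` L] i -> W i (f i)) /\ x = \sum_(i \in [set` L]) f i]
  = [set x | decomposes L x].
  by apply/seteqP; split=> x [f [Wf ->]]; exists f; split=> //;
    rewrite fsbig_finite// set_fsetK.
by [].
Qed.

Lemma decomposes0 L : decomposes L 0.
Proof. by exists (fun=> 0); split=> [w _|]; rewrite ?W0 ?big1. Qed.

Lemma decomposesD L x y : decomposes L x -> decomposes L y ->
  decomposes L (x + y).
Proof.
move=> [f [Wf ->]] [g [Wg ->]]; exists (fun w => f w + g w); split.
  move=> w wL; have [_ WD _] := closedW w.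
  by rewrite -[f w]scale1r; apply: WD; [exact: Wf|exact: Wg].
by rewrite big_split.
Qed.

Lemma decomposes_sum L (r : seq T) (f : T -> H) :
  (forall w, w \in r -> decomposes L (f w)) ->
  decomposes L (\sum_(w <- r) f w).
Proof.
move=> Lf; rewrite big_seq; elim/big_ind : _ => //.
- exact: decomposes0.
- exact: decomposesD.
Qed.

Lemma decomposes_mem L w x : w \in L -> W w x -> decomposes L x.
Proof.
move=> wL Wx; exists (fun v => if v == w then x else 0); split.
  by move=> v _; case: eqP => [->|].
rewrite (bigD1_seq w)//= eqxx big1 ?addr0// => v /negPf->//.
Qed.

Lemma decomposes_children w x : W w x -> decomposes (children w) x.
Proof.
case: tW => _ _ /(_ w) /orthogonal_sum_fset[_ ->].
by [].
Qed.

Lemma subspace_child v w x : v \in children w -> W v x -> W w x.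
Proof.
move=> vw Wx; case: tW => _ _ /(_ w) /orthogonal_sum_fset[_ ->].
exact: decomposes_mem vw Wx.
Qed.

Lemma subspace_iter_parent n w x : W w x -> W (iter n (@parent T) w) x.
Proof.
elim: n => //= n IH /IH; set v := iter n _ w.
have [->|vr] := eqVneq v (root T); first by rewrite parent_root.
by apply: subspace_child; rewrite childrenP vr eqxx.
Qed.

(** Two distinct active nodes are orthogonal because the ancestor of the deeper
    one at the depth of the other is a different node of that level. The
    active subspaces span because each node at depth N has an active ancestor,
    whose subspace contains its own. *)
Lemma active_partition_orthogonal_sum N L : active_partition N L ->
  orthogonal_sum [set` L] W [set: H].
Proof.
move=> [LN anti uniqL]; have [_ levels _] := tW.
apply/orthogonal_sum_fset; split.
  move=> v w vL wL; wlog vw : v w vL wL / (depth v <= depth w)%N.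
    move=> th vw x y Wx Wy; case/orP: (leq_total (depth v) (depth w)) => le.
      exact: th vw _ _ Wx Wy.
    by rewrite innerC (th w v)// ?rmorph0// => wv; apply: vw.
  move=> neq x y Wx Wy; set u := iter (depth w - depth v) (@parent T) w.
  have [orth _] := levels (depth v); apply: (orth v u) => //.
  - by rewrite /= depth_iter_parent subKn.
  - by move=> vu; apply/neq/anti => //; exists (depth w - depth v)%N.
  - exact: subspace_iter_parent.
apply/esym/seteqP; split=> // x _.
have [_ /seteqP[+ _]] := levels N => /(_ x I)[f [Wf ->]].
apply: decomposes_sum => z.
have [finf|inff] := pselect (finite_set ([set w | depth w = N] `&`
    f @^-1` [set~ 0])); last by rewrite no_finite_support.
rewrite in_finite_support// inE => -[zN _].
have [w [[wL [n nw]] _]] := uniqL z zN.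
apply: (decomposes_mem wL); rewrite -nw.
exact/subspace_iter_parent/Wf.
Qed.

(** The decomposition of the component along [w] over the children is inserted
    into the one over [L]; the children are orthogonal to the other nodes because
    [w] is. *)
Lemma refine_orthogonal_sum L w : w \in L ->
  orthogonal_sum [set` L] W [set: H] ->
  orthogonal_sum [set` refine L w] W [set: H].
Proof.
move=> wL /orthogonal_sum_fset[oL dL]; apply/orthogonal_sum_fset; split.
  have old v u : v \in L -> v <> w -> u \in children w ->
      forall x y, W v x -> W u y -> inner x y = 0.
    by move=> vL vw uw x y Wx /(subspace_child uw); exact: (oL v w).
  have [_ _ /(_ w) /orthogonal_sum_fset[och _]] := tW.
  move=> v u; rewrite !inE => /orP[/andP[/eqP vw vL]|vc] /orP[/andP[/eqP uw uL]|uc].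
  - exact: oL.
  - by move=> _; exact: old.
  - by move=> _ x y Wx Wy; rewrite innerC (old u v)// ?rmorph0.
  - exact: och.
apply/esym/seteqP; split=> // x _.
have /seteqP[/(_ x I)[f [Wf ->]] _] := dL.
apply: decomposes_sum => v vL; have Wv := Wf v vL.
have [vw|vw] := eqVneq v w; last first.
  by apply: decomposes_mem Wv; rewrite !inE vw vL.
rewrite vw in Wv *; have [g [Wg ->]] := decomposes_children Wv.
apply: decomposes_sum => u uw; apply: decomposes_mem (Wg u uw).
by rewrite !inE uw orbT.
Qed.

Section Projections.
Variable L : {fset T}.
Hypothesis oL : orthogonal_sum [set` L] W [set: H].

(** The orthogonal projections exist because the component along [W w] of a
    decomposition is the projection on [W w]. *)
Lemma component_projection (f : T -> H) w : w \in L ->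
  (forall v, v \in L -> W v (f v)) ->
  projection_of (W w) (\sum_(v <- L) f v) (f w).
Proof.
have [orth _] := (orthogonal_sum_fset L [set: H]).1 oL.
move=> wL Wf; split; first exact: Wf.
move=> y Wy; rewrite (bigD1_seq w)//= addrC addrK.
rewrite inner_suml big_seq_cond big1// => v /andP[vL vw].
by apply: orth (Wf v vL) Wy => //; exact/eqP.
Qed.

Lemma projection_exists w x : w \in L -> exists p, projection_of (W w) x p.
Proof.
move=> wL; have [_ /seteqP[/(_ x I)[f [Wf ->]] _]] :=
  (orthogonal_sum_fset L [set: H]).1 oL.
by exists (f w); exact: component_projection.
Qed.

Lemma sum_projections x : \sum_(w <- L) orth_proj (W w) x = x.
Proof.
have [_ /seteqP[/(_ x I)[f [Wf xE]] _]] :=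
  (orthogonal_sum_fset L [set: H]).1 oL.
rewrite [RHS]xE; apply: eq_big_seq => w wL.
by apply: orth_projE (closedW w) _; rewrite xE; exact: component_projection.
Qed.

End Projections.

End Decompositions.

(** * Contraction estimates *)

Section Estimates.
Context {R : realType}.
Local Open Scope ereal_scope.

(** For a finite, r <= a - d and d >= a/c. For a infinite the right-hand side is
    infinite too, except when c = 1, where it is 0. *)
Lemma le_contraction (r d a : \bar R) (c : R) : 0 <= r -> 0 <= d ->
    r + d <= a -> (1 <= c)%R -> a <= c%:E * d -> (c = 1%R -> r = 0) ->
  r <= (1 - 1 / c)%:E * a.
Proof.
move=> r0 d0 rda c1 ad cr.
have [cE|cN1] := eqVneq c 1%R.
  by rewrite cr// cE divr1 subrr mul0e.
have k0 : (0 < 1 - 1 / c)%R.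
  have c0 : (0 < c)%R by rewrite (lt_le_trans ltr01).
  by rewrite subr_gt0 ltr_pdivrMr// mul1r lt_neqAle eq_sym cN1.
case: a rda ad => [a|_ _|]; last first.
- by rewrite leeNy_eq => /eqP; move: r d r0 d0 {cr} => [r||] [d||].
- by rewrite gt0_muley ?lte_fin// leey.
- move: r d r0 d0 {cr} => [r||] [d||]//; rewrite -?EFinD -?EFinM !lee_fin.
  move=> r0 d0 rda ad.
  have c0 : (0 < c)%R by rewrite (lt_le_trans ltr01).
  have : (a / c <= d)%R by rewrite ler_pdivrMr// mulrC.
  by rewrite mul1r mulrBl mul1r [(c^-1 * _)%R]mulrC; lra.
Qed.

(** Here c a = a - t/n when a is finite and nonzero. In the degenerate cases (a
    zero or infinite, or t infinite) the conventions for [fine] and for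
    division by zero give c = 1. The sign of c is what allows the one-step
    estimates to be multiplied. *)
Lemma gamma_contraction (r d a t : \bar R) (n : R) : 0 <= r -> 0 <= d ->
    0 <= t -> r + d <= a -> (0 < n)%R -> t <= n%:E * d ->
  let c := (1 - 1 / (fine a / fine t * n))%R in (0 <= c)%R /\ r <= c%:E * a.
Proof.
move=> r0 d0 t0 rda n0 td c.
have ra : r <= a by apply: le_trans rda; rewrite leeDl.
have triv : c = 1%R -> (0 <= c)%R /\ r <= c%:E * a by move=> ->; rewrite mul1e.
have [afin|] := boolP (a \is a fin_num); last first.
  rewrite fin_numE negb_and !negbK => /orP[]/eqP aE;
  by apply: triv; rewrite /c aE /= !mul0r invr0 mulr0 subr0.
have [tfin|] := boolP (t \is a fin_num); last first.
  rewrite fin_numE negb_and !negbK => /orP[]/eqP tE;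
  by apply: triv; rewrite /c tE /= invr0 mulr0 mul0r invr0 mulr0 subr0.
have [a0|aN0] := eqVneq (fine a) 0%R.
  by apply: triv; rewrite /c a0 !mul0r invr0 mulr0 subr0.
have a0 : (0 < fine a)%R.
  by rewrite lt_neqAle eq_sym aN0 fine_ge0// (le_trans r0).
rewrite {triv ra}/c.
move: a t afin tfin a0 td rda t0 {aN0} => [a||] [t||]//= _ _ a0.
move: r d r0 d0 => [r||] [d||]//; rewrite -?EFinD -?EFinM !lee_fin.
move=> r0 d0 td rda t0.
have rc : (r <= (1 - 1 / (a / t * n)) * a)%R.
  have -> : ((1 - 1 / (a / t * n)) * a = a - t / n)%R.
    by rewrite mul1r !invfM invrK; field; rewrite !gt_eqF.
  have : (t / n <= d)%R by rewrite ler_pdivrMr// mulrC.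
  lra.
split=> //; rewrite -(pmulr_lge0 _ a0); exact: le_trans r0 rc.
Qed.

Lemma iterate_contraction (a : nat -> \bar R) (c : nat -> R) m :
    (forall j, (j < m)%N -> (0 <= c j)%R) ->
    (forall j, (j < m)%N -> a j.+1 <= (c j)%:E * a j) ->
  a m <= (\prod_(0 <= j < m) c j)%:E * a 0%N.
Proof.
elim: m => [|m IH] c0 ac; first by rewrite big_geq// mul1e.
rewrite big_nat_recr//= mulrC EFinM -muleA; apply: (le_trans (ac m _)) => //.
apply: lee_wpmul2l; first by rewrite lee_fin c0.
by apply: IH => j jm; [apply: c0|apply: ac]; exact: ltnW.
Qed.

Lemma sum_le_size (T : eqType) (l : seq T) (f : T -> \bar R) d : 0 <= d ->
  (forall w, w \in l -> f w <= d) -> \sum_(w <- l) f w <= (size l)%:R%:E * d.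
Proof.
move=> d0; elim: l => [|k l IH] fd; first by rewrite big_nil mul0e.
rewrite big_cons /= -nat1r EFinD ge0_muleDl ?lee_fin//.
rewrite mul1e leeD ?fd ?mem_head//.
by apply: IH => w wl; rewrite fd// in_cons wl orbT.
Qed.

End Estimates.

(** The Cauchy-Schwarz inequality for sums, by induction: the increment of the
    difference of the two sides is the sum of the |f_k - f_i|^2. *)
Lemma norm_sqr_sum_le {R : realType} {s : scalar_kind} {H : hilbert R s}
    (I : Type) (r : seq I) (f : I -> H) :
  inner (\sum_(i <- r) f i) (\sum_(i <- r) f i) <=
  (size r)%:R * \sum_(i <- r) inner (f i) (f i).
Proof.
elim: r => [|k r IH]; first by rewrite !big_nil inner0l mul0r.
rewrite !big_cons /= -nat1r; set S := \sum_(i <- r) f i in IH *.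
set q := \sum_(i <- r) inner (f i) (f i) in IH *.
have : 0 <= \sum_(i <- r) inner (f k - f i) (f k - f i).
  by apply: sumr_ge0 => i _; exact: inner_ge0.
have -> : \sum_(i <- r) inner (f k - f i) (f k - f i) =
    (size r)%:R * inner (f k) (f k) + q - inner (f k) S - inner S (f k).
  rewrite /S /q inner_sumr inner_suml; elim: r {IH S q} => [|i r IH].
    by rewrite !big_nil mul0r !subr0 addr0.
  rewrite !big_cons IH /= -nat1r !(innerBl, innerBr); ring.
move: IH; rewrite !(innerDl, innerDr) -subr_ge0 => IH /(addr_ge0 IH).
by move=> le; rewrite -subr_ge0; move: le; congr (_ <= _); ring.
Qed.

Section Contents.
Context {R : realType} {s : scalar_kind} {H : hilbert R s} {T : rooted_tree}.
Variables (E : set H) (W : T -> set H).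
Hypothesis bE : orthonormal_basis E.
Hypothesis tW : subspace_tree W.

Lemma trace_ge0 A : positive_op A -> (0 <= @trace R s H E A)%E.
Proof.
by move=> [_ _ pA]; apply: esum_ge0 => e _; rewrite lee_fin sre_ge0.
Qed.

Section OneStep.
Variables (L : {fset T}) (A : H -> H) (w : T).
Hypothesis oL : orthogonal_sum [set` L] W [set: H].
Hypothesis pA : positive_op A.
Hypothesis wL : w \in L.

Let closedW v : closed_subspace (W v). Proof. by case: tW. Qed.

(** The projections of the active nodes add up to the identity, between two
    square roots. *)
Lemma sum_contents x : \sum_(v <- L) content W v A x = A x.
Proof.
have [[[lS _] _ _] SS] := op_sqrtP pA.
rewrite -[in RHS]SS /= -[in RHS](sum_projections tW oL (op_sqrt A x)).
apply: esym; elim/big_rec2: _ => [|v y z _ <-]; first exact: lin0.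
by rewrite (linD _ _ lS).
Qed.

Lemma content_positive v : v \in L -> positive_op (content W v A).
Proof.
move=> vL; have [pS _] := op_sqrtP pA.
apply: positive_sandwich => //; apply: (orth_proj_positive (closedW v)) => x.
exact: (projection_exists oL x vL).
Qed.

(** A - A^(1/2) P A^(1/2) = A^(1/2) (1 - P) A^(1/2). *)
Lemma remainder_positive v : v \in L -> positive_op (A - content W v A).
Proof.
move=> vL; have [pS SS] := op_sqrtP pA; have [[lS _] _ _] := pS.
have -> : A - content W v A
  = op_sqrt A \o (fun x => x - orth_proj (W v) x) \o op_sqrt A.
  apply/funext => x /=; rewrite (linB _ _ lS).
  by move: (congr1 (@^~ x) SS) => /= ->.
apply: positive_sandwich => //; apply: (orth_proj_compl_positive (closedW v)) => x.
exact: (projection_exists oL x vL).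
Qed.

Lemma trace_remainder :
  (trace E (A - content W w A)%R + trace E (content W w A) = trace E A)%E.
Proof.
have [[_ _ pD] [_ _ pr]] := (content_positive wL, remainder_positive wL).
rewrite /trace -esumD; try by move=> e _; rewrite lee_fin sre_ge0.
apply: eq_esum => e _; rewrite -EFinD -raddfD -innerDl.
by congr (sre (inner _ _))%:E; rewrite /= subrK.
Qed.

Lemma trace_sum_contents :
  (trace E A = \sum_(v <- L) trace E (content W v A))%E.
Proof.
rewrite big_seq -esum_sum; last first.
  by move=> e v _ vL; have [_ _ pD] := content_positive vL; rewrite lee_fin sre_ge0.
apply: eq_esum => e _; rewrite -big_seq sumEFin -raddf_sum -inner_suml.
by rewrite sum_contents.
Qed.

Lemma hs_sqr_remainder :
  (hs_sqr E (A - content W w A)%R + hs_sqr E (content W w A) <= hs_sqr E A)%E.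
Proof.
have := hs_sqr_superadditive bE (remainder_positive wL) (content_positive wL).
congr (_ <= hs_sqr E _)%E; apply/funext => x /=; exact: subrK.
Qed.

(** Pointwise on the basis, from A e being the sum of the contents applied to
    e. *)
Lemma hs_sqr_le_contents : (hs_sqr E A <=
  (#|` L|%:R)%:E * \sum_(v <- L) hs_sqr E (content W v A))%E.
Proof.
rewrite big_seq -esum_sum; last by move=> e v _ _; exact: sre_inner_ge0.
apply: ge_ereal_sup => _ [F [finF FE] <-].
apply: (@le_trans _ _ (\sum_(e \in F) (#|` L|%:R)%:E *
  (\sum_(v <- L | v \in L) (sre (inner (content W v A e) (content W v A e)))%:E)))%E.
  apply: lee_fsum => // e _; rewrite -big_seq sumEFin -EFinM lee_fin -raddf_sum.
  rewrite -(sum_contents e); apply: (le_trans (sre_le (norm_sqr_sum_le _ _))).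
  by rewrite mulr_natl raddfMn [leRHS]mulr_natl.
rewrite fsbig_finite//= -ge0_sume_distrr; last first.
  by move=> e _; apply: sume_ge0 => v _; exact: sre_inner_ge0.
apply: lee_wpmul2l; first by rewrite lee_fin.
by apply: esum_ge; exists F => //; rewrite fsbig_finite.
Qed.

Lemma remainder_single : #|` L| = 1%N -> A - content W w A = 0.
Proof.
move/eqP/cardfs1P => [v Lv]; move: (wL); rewrite {1}Lv inE => /eqP wv.
apply/funext => x; rewrite -[LHS]/(A x - content W w A x).
by rewrite -{1}(sum_contents x) Lv big_seq_fset1 -wv subrr.
Qed.

End OneStep.

(** The depth bound is part of the invariant since the process only prescribes
    the next partition when the chosen node has depth at most N. *)
Lemma extraction_invariant N Rop (L : nat -> {fset T}) (w : nat -> T)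
    (D Rk : nat -> H -> H) k :
  positive_op Rop -> extraction_process W N Rop L w D Rk ->
  [/\ positive_op (Rk k), orthogonal_sum [set` L k] W [set: H] &
      forall v, v \in L k -> (depth v <= N)%N].
Proof.
move=> pR [aL R0 step]; elim: k => [|k [pk ok dk]].
  by rewrite R0; split=> //; [exact: active_partition_orthogonal_sum aL|case: aL].
have [wL refL sameL DE RE] := step k; split.
- by rewrite RE DE; exact: (remainder_positive ok).
- have [wN|wN|wN] := ltngtP (depth (w k.+1)) N.
  + by rewrite refL//; exact: refine_orthogonal_sum.
  + by have := dk _ wL; rewrite leqNgt wN.
  + by rewrite sameL.
- have [wN|wN|wN] := ltngtP (depth (w k.+1)) N.
  + move=> v; rewrite refL// !inE => /orP[/andP[_ /dk]//|/depth_child vw].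
    exact: leq_trans vw wN.
  + by have := dk _ wL; rewrite leqNgt wN.
  + by rewrite sameL.
Qed.

End Contents.

(** * Greedy extraction *)

Theorem theorem6p9 (R : realType) (s : scalar_kind) (H : hilbert R s)
    (E : set H) (T : rooted_tree) (W : T -> set H) (N : nat) (Rop : H -> H)
    (L : nat -> {fset T}) (w : nat -> T) (D Rk : nat -> H -> H) :
  orthonormal_basis E ->
  subspace_tree W ->
  (1 <= N)%N ->
  trace_class E Rop ->
  positive_op Rop ->
  extraction_process W N Rop L w D Rk ->
  (trace_greedy E W L w Rk ->
    (forall k, (1 <= k)%N ->
      (trace E (Rk k) <=
       (1 - 1 / (#|` L k.-1|)%:R)%:E * trace E (Rk k.-1))%E) /\
    (forall m, (1 <= m)%N ->
      (trace E (Rk m) <=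
       (\prod_(0 <= j < m) (1 - 1 / (#|` L j|)%:R))%:E * trace E Rop)%E)) /\
  (hs_greedy E W L w Rk ->
    (forall k, (1 <= k)%N -> Gamma_defined E W (L k.-1) (Rk k.-1) ->
      (hs_norm E (Rk k) ^+ 2 <=
       (1 - 1 / (Gamma E W (L k.-1) (Rk k.-1) * (#|` L k.-1|)%:R))%:E *
       hs_norm E (Rk k.-1) ^+ 2)%E) /\
    (forall m, (1 <= m)%N ->
      (forall j, (j < m)%N -> Gamma_defined E W (L j) (Rk j)) ->
      (hs_norm E (Rk m) ^+ 2 <=
       (\prod_(0 <= j < m)
          (1 - 1 / (Gamma E W (L j) (Rk j) * (#|` L j|)%:R)))%:E *
       hs_norm E Rop ^+ 2)%E) /\
    (forall m, (1 <= m)%N ->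
      (hs_norm E (Rk m) ^+ 2 <=
       (\prod_(0 <= j < m) (1 - 1 / ((#|` L j|)%:R ^+ 2)))%:E *
       hs_norm E Rop ^+ 2)%E)).
Proof.
move=> bE tW _ _ pR extr.
have inv k := extraction_invariant tW k pR extr.
have [_ R0 step] := extr.
have remE k : Rk k.+1 = Rk k - content W (w k.+1) (Rk k).
  by have [_ _ _ <- ->] := step k.
have wL k : w k.+1 \in L k by have [] := step k.
have card_gt0 k : (0 < #|` L k|)%N.
  by rewrite cardfs_gt0; apply/fset0Pn; exists (w k.+1).
have cardR_ge1 k : 1 <= #|` L k|%:R :> R by rewrite ler1n.
have cardR_gt0 k : 0 < #|` L k|%:R :> R by rewrite ltr0n.
(* A single active node gives the factor 0, so the remainder has to vanish; its
   subspace is all of H and the content removed is the whole operator. *)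
have single k : #|` L k| = 1%N -> Rk k.+1 = 0.
  by have [pk ok _] := inv k; rewrite remE; exact: remainder_single.
split=> greedy.
- have stepT k : (trace E (Rk k.+1) <=
      (1 - 1 / #|` L k|%:R)%:E * trace E (Rk k))%E.
    have [pk ok _] := inv k; have [pk1 _ _] := inv k.+1.
    have pD := content_positive tW ok pk (wL k).
    apply: (le_contraction (trace_ge0 _ pk1) (trace_ge0 _ pD)) => //.
    + by rewrite -(trace_remainder E tW ok pk (wL k)) remE; exact: lexx.
    + rewrite (trace_sum_contents E tW ok pk).
      by apply: sum_le_size (trace_ge0 _ pD) _ => v; exact: greedy.
    + move=> /eqP; rewrite pnatr_eq1 => /eqP/single ->; apply: esum1 => e _.
      by rewrite [inner _ _]inner0l raddf0.
  split=> [[//|k] _|m _]; first exact: stepT.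
  rewrite -R0; apply: (iterate_contraction (a := fun k => trace E (Rk k))) => j _;
    last exact: stepT.
  by rewrite subr_ge0 ler_pdivrMr ?cardR_gt0// mul1r cardR_ge1.
- have rD k : (hs_sqr E (Rk k.+1) + hs_sqr E (content W (w k.+1) (Rk k))
      <= hs_sqr E (Rk k))%E.
    have [pk ok _] := inv k; rewrite remE.
    exact: (hs_sqr_remainder bE tW ok pk (wL k)).
  have denD k : (\sum_(v <- L k) hs_sqr E (content W v (Rk k)) <=
      (#|` L k|%:R)%:E * hs_sqr E (content W (w k.+1) (Rk k)))%E.
    apply: sum_le_size (hs_sqr_ge0 _ _) _ => v vL.
    exact/hs_norm_le/greedy.
  have stepG k :
      let c := 1 - 1 / (Gamma E W (L k) (Rk k) * #|` L k|%:R) in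
      0 <= c /\ (hs_sqr E (Rk k.+1) <= c%:E * hs_sqr E (Rk k))%E.
    rewrite /Gamma /gamma_den sqr_hs_norm.
    under eq_bigr do rewrite sqr_hs_norm.
    apply: gamma_contraction (rD k) _ (denD k) => //; try exact: hs_sqr_ge0.
    by apply: sume_ge0 => v _; exact: hs_sqr_ge0.
  have stepN k : (hs_sqr E (Rk k.+1) <=
      (1 - 1 / (#|` L k|%:R ^+ 2))%:E * hs_sqr E (Rk k))%E.
    have [pk ok _] := inv k.
    apply: le_contraction (hs_sqr_ge0 _ _) (hs_sqr_ge0 _ _) (rD k) _ _ _.
    + by rewrite exprn_ege1.
    + apply: (le_trans (hs_sqr_le_contents E tW ok pk)).
      rewrite expr2 EFinM -muleA; apply: lee_wpmul2l (denD k).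
      by rewrite lee_fin ltW.
    + move=> /eqP; rewrite expr2 -natrM pnatr_eq1 muln_eq1 andbb => /eqP/single->.
      by apply: esum1 => e _; rewrite [inner _ _]inner0l raddf0.
  split=> [[//|k] _ _|]; first by rewrite !sqr_hs_norm; case: (stepG k).
  split=> m _.
    move=> _; rewrite !sqr_hs_norm -R0.
    by apply: (iterate_contraction (a := fun k => hs_sqr E (Rk k))) => j _;
      case: (stepG j).
  rewrite !sqr_hs_norm -R0.
  apply: (iterate_contraction (a := fun k => hs_sqr E (Rk k))) => j _;
    last exact: stepN.
  by rewrite subr_ge0 ler_pdivrMr ?exprn_gt0// mul1r exprn_ege1.
Qed.
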